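(* Let $\Omega\subset\mathbb{R}^n$ be a strictly convex bounded domain. The group of Funk isometries of $\Omega$ coincides with the subgroup of the affine group of $\mathbb{R}^n$ leaving $\Omega$ invariant; that is, the Funk isometries of $\Omega$ are exactly the restrictions to $\Omega$ of the affine transformations $g$ of $\mathbb{R}^n$ with $g(\Omega)=\Omega$.
   Context: The domain $\Omega$ is a non-empty bounded open convex subset of $\mathbb{R}^n$; it is strictly convex if $\partial\Omega$ contains no non-trivial segment. For $x\neq y$ in $\Omega$, let $a_\Omega(x,y)$ be the unique intersection point of the ray $\{x+t(y-x):t\ge0\}$ with $\partial\Omega$. The Funk metric is $F_\Omega(x,x)=0$ and $F_\Omega(x,y)=\log\frac{|x-a|}{|y-a|}$, $a=a_\Omega(x,y)$, for $x\ne y$. A Funk isometry of $\Omega$ is a bijection $f:\Omega\to\Omega$ with $F_\Omega(f(x),f(y))=F_\Omega(x,y)$ for all $x,y\in\Omega$. *)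

(* Defs.v *)
From HB Require Import structures.
From mathcomp Require Import all_boot all_order all_algebra.
From mathcomp Require Import all_classical all_reals all_analysis.
Set Implicit Arguments.
Unset Strict Implicit.
Unset Printing Implicit Defensive.
Import Order.TTheory GRing.Theory Num.Theory.
Import numFieldNormedType.Exports.
Local Open Scope classical_set_scope.
Local Open Scope ring_scope.

Section FunkMetric.
Context {R : realType} {n : nat}.
Implicit Types (x y v : 'rV[R]_n) (Omega : set 'rV[R]_n).

(* The library norm on 'rV[R]_n is the sup norm; it induces the same topology
   and the same bounded sets as this one. *)
Definition euclidean_norm v : R := Num.sqrt (\sum_(i < n) v 0 i ^+ 2).

Definition boundary (T : topologicalType) (A : set T) : set T :=
  closure A `\` interior A.

Definition segment x y : set 'rV[R]_n :=
  [set (1 - t) *: x + t *: y | t in [set t : R | 0 <= t <= 1]].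

Definition ray x y : set 'rV[R]_n :=
  [set x + t *: (y - x) | t in [set t : R | 0 <= t]].

Definition bounded_convex_domain Omega : Prop :=
  [/\ Omega !=set0, bounded_set Omega, open Omega & convex_set Omega].

Definition boundary_has_no_segment Omega : Prop :=
  forall x y, x != y -> ~ (segment x y `<=` boundary Omega).

Definition strictly_convex_domain Omega : Prop :=
  bounded_convex_domain Omega /\ boundary_has_no_segment Omega.

(* When Omega is a bounded convex domain and x != y are in Omega, the set below
   is a singleton, and get returns its element. *)
Definition exit_point Omega x y : 'rV[R]_n :=
  get (ray x y `&` boundary Omega).

Definition funk_metric Omega x y : R :=
  if x == y then 0
  else let a := exit_point Omega x y in
       ln (euclidean_norm (x - a) / euclidean_norm (y - a)).

(* f is a self-map of the subtype {x | x \in Omega}. *)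
Definition funk_isometry Omega (f : Omega -> Omega) : Prop :=
  bijective f /\
  forall x y : Omega,
    funk_metric Omega (val (f x)) (val (f y)) =
    funk_metric Omega (val x) (val y).

Definition affine_transformation (g : 'rV[R]_n -> 'rV[R]_n) : Prop :=
  exists2 A : 'M[R]_n, A \in unitmx & exists b, forall x, g x = x *m A + b.

Definition restricts_to Omega (g : 'rV[R]_n -> 'rV[R]_n)
    (f : Omega -> Omega) : Prop :=
  forall x : Omega, val (f x) = g (val x).

End FunkMetric.

(* Main.v *)
Require Import Defs.
From HB Require Import structures.
From mathcomp Require Import all_boot all_order all_algebra.
From mathcomp Require Import all_classical all_reals all_analysis.
From mathcomp Require Import ring lra.
Set Implicit Arguments.
Unset Strict Implicit.
Unset Printing Implicit Defensive.
Import Order.TTheory GRing.Theory Num.Theory.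
Import numFieldNormedType.Exports.
Local Open Scope classical_set_scope.
Local Open Scope ring_scope.

(** For x != y in Omega let T(x,y) > 1 be the time at which the ray
    x + t (y - x) leaves Omega (predicate [exit_time]).  The Funk distance is
    ln (T / (T - 1)), an injective function of T, so that the Funk isometries
    are the bijections of Omega preserving exit times
    ([funk_metric_exit_time], [exit_time_funk_metric]).

    Exit times only involve membership in Omega along rays, so an affine
    bijection that leaves Omega invariant preserves them ([exit_time_affine]).

    Conversely, let f be a Funk isometry.  If z = x + t (y - x) with 0 < t < 1
    and U = T(x,y), then T(x,z) = U / t and T(z,y) = (U - t) / (1 - t), whence
    F(x,z) + F(z,y) = F(x,y).  When Omega is strictly convex, this equality
    forces z to lie on the segment from x to y, at the place determined by the
    two exit times T(x,z) and T(x,y) ([triangle_equality_collinear]): equality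
    says that the exit point of the ray from x to y is a weighted mean, with
    positive weights, of the exit points of the rays from x to z and from z to
    y, and strict convexity makes the three points coincide.  Applied to the
    images under f, it gives f z = f x + t (f y - f x)
    ([funk_isometry_chord]): f is affine on every chord.  A map that is affine on the chords of a nonempty open set is
    the restriction of an affine map ([chord_affine_extension]), and the
    bijectivity of f makes this map invertible and Omega invariant. *)

(** * Points of open convex sets and their closures *)

Section ConvexSets.
Context {R : realType} {n : nat}.
Implicit Types (x y z p v : 'rV[R]_n) (Omega : set 'rV[R]_n) (s t T : R).

Lemma convex_setP Omega x y t : convex_set Omega ->
  Omega x -> Omega y -> 0 <= t <= 1 -> Omega (x + t *: (y - x)).
Proof.
move=> cO Ox Oy /andP[t0 t1].
have := cO y x (Itv01 t0 t1); rewrite !inE => /(_ Oy Ox).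
congr (Omega _).
rewrite /conv /= /unstable.onem.
by apply/rowP => i; rewrite !mxE; ring.
Qed.

Lemma open_ball Omega x : open Omega -> Omega x ->
  exists2 e : R, 0 < e & forall y, `|y - x| < e -> Omega y.
Proof.
move=> oO Ox; have /nbhs_ballP[e /= e0 He] : nbhs x Omega.
  exact: open_nbhs_nbhs.
by exists e => // y yx; apply: He; rewrite -ball_normE /= distrC.
Qed.

Lemma open_line Omega x v : open Omega -> Omega x ->
  exists2 e : R, 0 < e & forall t, `|t| < e -> Omega (x + t *: v).
Proof.
move=> oO Ox; have [e e0 He] := open_ball oO Ox.
have v1 : 0 < `|v| + 1 by rewrite ltr_wpDl.
exists (e / (`|v| + 1)); first by rewrite divr_gt0.
move=> t; rewrite ltr_pdivlMr// => te; apply: He.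
rewrite addrC addKr normrZ (le_lt_trans _ te)//.
by rewrite ler_wpM2l// lerDl.
Qed.

Lemma closure_ball Omega x :
  (forall e : R, 0 < e -> exists2 y, Omega y & `|y - x| < e) -> closure Omega x.
Proof.
move=> H B /nbhs_ballP[e /= e0 He]; have [y Oy yx] := H e e0.
by exists y; split => //; apply: He; rewrite -ball_normE /= distrC.
Qed.

(** The endpoint of a half-open segment lying in Omega is in its closure. *)
Lemma closure_line Omega x v T : 0 < T ->
  (forall t, 0 <= t < T -> Omega (x + t *: v)) -> closure Omega (x + T *: v).
Proof.
move=> T0 H; apply: closure_ball => e e0.
have v1 : 0 < `|v| + 1 by rewrite ltr_wpDl.
have ev : 0 < e / (`|v| + 1) by rewrite divr_gt0.
pose d := Num.min T (e / (`|v| + 1)).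
have d0 : 0 < d by rewrite lt_min T0.
exists (x + (T - d) *: v).
  by apply: H; rewrite subr_ge0 ge_min lexx /= gtrBl.
rewrite (_ : _ - _ = (- d) *: v); last by apply/rowP => i; rewrite !mxE; ring.
rewrite normrZ normrN gtr0_norm//.
apply: (@le_lt_trans _ _ (e / (`|v| + 1) * `|v|)).
  by rewrite ler_wpM2r// ge_min lexx orbT.
by rewrite mulrAC ltr_pdivrMr// ltr_pM2l// ltrDl.
Qed.

(** A segment from a point of an open convex set to a point of its closure stays
    in the set, except possibly at its endpoint. *)
Lemma convex_open_closure Omega x p s : convex_set Omega -> open Omega ->
  Omega x -> closure Omega p -> 0 <= s < 1 -> Omega (x + s *: (p - x)).
Proof.
move=> cO oO Ox cp /andP[s0 s1].
have [e e0 He] := open_ball oO Ox.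
have s1' : 0 < 1 - s by rewrite subr_gt0.
have e1 : 0 < e * (1 - s) by rewrite mulr_gt0.
(* The point p is moved to a nearby q in Omega, and x to x', so that the
   division point of the segment does not change. *)
have [q [Oq pq]] := cp _ (nbhsx_ballx p _ e1).
rewrite -ball_normE /= in pq.
pose x' := x + (s / (1 - s)) *: (p - q).
have Ox' : Omega x'.
  apply: He; rewrite addrC addKr normrZ ger0_norm ?divr_ge0// ?ltW//.
  rewrite mulrAC ltr_pdivrMr//; apply: le_lt_trans pq.
  by rewrite ler_piMl// ltW.
have := @convex_setP _ _ _ s cO Ox' Oq; rewrite s0 ltW// => /(_ isT).
congr (Omega _); apply/rowP => i; rewrite !mxE; field.
by rewrite gt_eqF.
Qed.

Lemma convex_closure Omega x p q t : convex_set Omega -> open Omega ->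
  Omega x -> closure Omega p -> closure Omega q -> 0 <= t <= 1 ->
  closure Omega (p + t *: (q - p)).
Proof.
move=> cO oO Ox cp cq t01.
rewrite (_ : _ + _ = x + 1 *: (p + t *: (q - p) - x)); last first.
  by apply/rowP => i; rewrite !mxE; ring.
apply: closure_line => // s s01.
have Op := convex_open_closure cO oO Ox cp s01.
have Oq := convex_open_closure cO oO Ox cq s01.
have := convex_setP cO Op Oq t01.
by congr (Omega _); apply/rowP => i; rewrite !mxE; ring.
Qed.

(** * Exit times and the Funk metric *)

(** The ray from x through y leaves Omega exactly at time T, where time 0 is
    x and time 1 is y.  The condition involves membership in Omega alone, not
    the topological boundary. *)
Definition exit_time Omega x y T :=
  forall t, 0 <= t -> (Omega (x + t *: (y - x)) <-> t < T).

Lemma exit_time_gt0 Omega x y T : Omega x -> exit_time Omega x y T -> 0 < T.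
Proof. by move=> Ox /(_ 0 (lexx _)) [+ _]; rewrite scale0r addr0; apply. Qed.

Lemma exit_time_gt1 Omega x y T : Omega y -> exit_time Omega x y T -> 1 < T.
Proof. by move=> Oy /(_ 1 ler01) [+ _]; rewrite scale1r addrC subrK; apply. Qed.

Lemma exit_time_exists Omega x y : convex_set Omega -> open Omega ->
  bounded_set Omega -> Omega x -> x != y -> exists T, exit_time Omega x y T.
Proof.
move=> cO oO bO Ox xy.
have [M HM] : exists M : R, forall z, Omega z -> `|z| <= M.
  by case: bO => M [_ HM]; exists (M + 1) => z Oz;
    apply: (HM (M + 1)) => //; rewrite ltrDl.
pose S := [set t : R | 0 <= t /\ Omega (x + t *: (y - x))].
have S0 : S 0 by split => //; rewrite scale0r addr0.
have v0 : 0 < `|y - x| by rewrite normr_gt0 subr_eq0 eq_sym.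
have Sb : has_ubound S.
  exists ((M + `|x|) / `|y - x|) => t [t0 /HM Ht].
  rewrite ler_pdivlMr// -[t]ger0_norm// -normrZ.
  rewrite -(addKr x (t *: _)) addrC (le_trans (ler_normB _ _))//.
  by rewrite lerD2r.
exists (sup S) => t t0; split => [Ot|].
  have [e e0 He] := open_line (y - x) oO Ot.
  apply: (@lt_le_trans _ _ (t + e / 2)); first by rewrite ltrDl divr_gt0.
  apply: ub_le_sup => //; split; first by rewrite addr_ge0// ltW// divr_gt0.
  rewrite scalerDl addrA; apply: He.
  by rewrite gtr0_norm ?divr_gt0// ltr_pdivrMr// ltr_pMr// ltr1n.
rewrite -subr_gt0 => /sup_adherent/(_ (conj (ex_intro _ _ S0) Sb)) [u [u0 Ou]].
rewrite opprB addrC subrK => tu.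
have u00 : 0 < u by exact: le_lt_trans tu.
have := @convex_setP _ _ _ (t / u) cO Ox Ou.
rewrite divr_ge0// ler_pdivrMr// mul1r ltW// => /(_ isT).
congr (Omega _); apply/rowP => i; rewrite !mxE; field.
by rewrite gt_eqF.
Qed.

Lemma exit_time_boundary Omega x y T : open Omega -> Omega x ->
  exit_time Omega x y T -> boundary Omega (x + T *: (y - x)).
Proof.
move=> oO Ox HT; have T0 := exit_time_gt0 Ox HT; split.
  by apply: closure_line => // t /andP[t0 tT]; apply/(HT t t0).
by move=> /interior_subset /(HT _ (ltW T0)); rewrite ltxx.
Qed.

(** The ray from x to y meets the boundary only once, at its exit time. *)
Lemma exit_time_unique Omega x y T t : convex_set Omega -> open Omega ->
  Omega x -> exit_time Omega x y T -> 0 <= t ->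
  boundary Omega (x + t *: (y - x)) -> t = T.
Proof.
move=> cO oO Ox HT t0 [ct nt]; have T0 := exit_time_gt0 Ox HT.
apply/eqP; case: ltgtP => // [tT|Tt]; exfalso.
  by apply: nt; rewrite ((interior_id _).1 oO); apply/(HT t t0).
have t00 : 0 < t by exact: le_lt_trans (ltW T0) Tt.
have := @convex_open_closure _ _ _ (T / t) cO oO Ox ct.
rewrite divr_ge0 ?ltW//= ltr_pdivrMr// mul1r Tt => /(_ isT).
rewrite addrAC subrr add0r scalerA divfK ?gt_eqF//.
by move=> /(HT _ (ltW T0)); rewrite ltxx.
Qed.

Lemma euclidean_normZ (c : R) v :
  euclidean_norm (c *: v) = `|c| * euclidean_norm v.
Proof.
rewrite /euclidean_norm -sqrtr_sqr -sqrtrM ?sqr_ge0//; congr Num.sqrt.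
by rewrite mulr_sumr; apply: eq_bigr => i _; rewrite mxE exprMn.
Qed.

Lemma euclidean_norm_gt0 v : v != 0 -> 0 < euclidean_norm v.
Proof.
move=> v0; rewrite /euclidean_norm sqrtr_gt0 lt_neqAle.
rewrite sumr_ge0 ?andbT; last by move=> i _; rewrite sqr_ge0.
rewrite eq_sym psumr_eq0; last by move=> i _; rewrite sqr_ge0.
apply: contra v0 => /allP v0; apply/eqP/rowP => i; rewrite mxE.
by apply/eqP; rewrite -sqrf_eq0; exact: (v0 i (mem_index_enum i)).
Qed.

Lemma funk_metric_exit_time Omega x y T : convex_set Omega -> open Omega ->
  Omega x -> Omega y -> x != y -> exit_time Omega x y T ->
  funk_metric Omega x y = ln (T / (T - 1)).
Proof.
move=> cO oO Ox Oy xy HT; have T0 := exit_time_gt0 Ox HT.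
have T1 := exit_time_gt1 Oy HT.
have aE : exit_point Omega x y = x + T *: (y - x).
  have [[t /= t0 tE] bt] :
      (ray x y `&` boundary Omega) (exit_point Omega x y).
    apply: getPex; exists (x + T *: (y - x)); split.
      by exists T => //=; exact: ltW.
    exact: exit_time_boundary.
  by rewrite -tE in bt *; rewrite (exit_time_unique cO oO Ox HT t0 bt).
have N0 : 0 < euclidean_norm (y - x).
  by apply: euclidean_norm_gt0; rewrite subr_eq0 eq_sym.
rewrite /funk_metric (negPf xy) /= aE.
rewrite (_ : x - _ = (- T) *: (y - x)); last first.
  by apply/rowP => i; rewrite !mxE; ring.
rewrite (_ : y - (_ + _) = (1 - T) *: (y - x)); last first.
  by apply/rowP => i; rewrite !mxE; ring.
rewrite !euclidean_normZ normrN (gtr0_norm T0) ler0_norm ?subr_le0 ?ltW// opprB.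
congr ln; field.
by rewrite !gt_eqF ?subr_gt0.
Qed.

Lemma ratio_gt0 T : 1 < T -> 0 < T / (T - 1).
Proof. by move=> T1; rewrite divr_gt0 ?subr_gt0// (lt_trans ltr01). Qed.

Lemma ln_ratio_inj S T : 1 < S -> 1 < T ->
  ln (S / (S - 1)) = ln (T / (T - 1)) -> S = T.
Proof.
move=> S1 T1.
have nS : S - 1 != 0 by rewrite subr_eq0 gt_eqF.
have nT : T - 1 != 0 by rewrite subr_eq0 gt_eqF.
move=> /ln_inj; rewrite !posrE !ratio_gt0//.
move=> /(_ isT isT) /eqP; rewrite eqr_div// => /eqP; lra.
Qed.

Lemma exit_time_funk_metric Omega x y x' y' T :
  convex_set Omega -> open Omega -> bounded_set Omega ->
  Omega x -> Omega y -> Omega x' -> Omega y' ->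
  x != y -> x' != y' -> funk_metric Omega x' y' = funk_metric Omega x y ->
  exit_time Omega x y T -> exit_time Omega x' y' T.
Proof.
move=> cO oO bO Ox Oy Ox' Oy' xy xy' FE HT.
have [T' HT'] := exit_time_exists cO oO bO Ox' xy'.
move: FE; rewrite (funk_metric_exit_time _ _ _ _ _ HT)//.
rewrite (funk_metric_exit_time _ _ _ _ _ HT')// => /ln_ratio_inj <-//.
  exact: exit_time_gt1 HT'.
exact: exit_time_gt1 HT.
Qed.

(** Exit times between the endpoints of a chord and an intermediate point. *)
Lemma exit_time_prefix Omega x y t T : 0 < t -> exit_time Omega x y T ->
  exit_time Omega x (x + t *: (y - x)) (T / t).
Proof.
move=> t0 HT s s0; rewrite ltr_pdivlMr//.
rewrite [x + t *: _ - x]addrC addKr scalerA.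
by apply: HT; rewrite mulr_ge0 // ltW.
Qed.

Lemma exit_time_suffix Omega x y t T : 0 <= t < 1 -> exit_time Omega x y T ->
  exit_time Omega (x + t *: (y - x)) y ((T - t) / (1 - t)).
Proof.
move=> /andP[t0 t1] HT s s0; rewrite ltr_pdivlMr ?subr_gt0// ltrBrDl.
rewrite (_ : _ + s *: _ = x + (t + s * (1 - t)) *: (y - x)).
  by apply: HT; rewrite addr_ge0// mulr_ge0// subr_ge0 ltW.
by apply/rowP => i; rewrite !mxE; ring.
Qed.

Lemma exit_time_affine Omega (g : 'rV[R]_n -> 'rV[R]_n) x y T :
  (forall z, Omega (g z) <-> Omega z) ->
  (forall t, g (x + t *: (y - x)) = g x + t *: (g y - g x)) ->
  exit_time Omega x y T -> exit_time Omega (g x) (g y) T.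
Proof.
move=> gO gE HT t t0; rewrite -gE; split; first by move/gO/(HT _ t0).
by move/(HT _ t0)/gO.
Qed.

(** * The equality case of the triangle inequality *)

(** In a strictly convex domain, the open segment between two distinct points of
    the closure lies inside. *)
Lemma open_segment_interior Omega p q t : convex_set Omega -> open Omega ->
  boundary_has_no_segment Omega -> Omega !=set0 ->
  closure Omega p -> closure Omega q -> p != q ->
  0 < t < 1 -> Omega (p + t *: (q - p)).
Proof.
move=> cO oO sO [x0 Ox0] cp cq pq /andP[t0 t1].
have [d [[s /= /andP[s0 s1] dE] Od]] : exists d, segment p q d /\ Omega d.
  apply: contrapT => H; apply: (sO _ _ pq) => d dpq; split.
    case: (dpq) => s /= s01 <-.
    rewrite (_ : _ + _ = p + s *: (q - p)); last first.
      by apply/rowP => i; rewrite !mxE; ring.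
    exact: (@convex_closure _ _ _ _ s cO oO Ox0 cp cq s01).
  by move/interior_subset => Od; apply: H; exists d.
have {}dE : d = p + s *: (q - p).
  by rewrite -dE; apply/rowP => i; rewrite !mxE; ring.
(* Some d on the segment is in Omega; any other point of the open segment
   lies between d and one of the endpoints. *)
case: (ltgtP t s) => [ts|st|ts]; last by rewrite ts -dE.
- have s0' : 0 < s by exact: lt_trans ts.
  have := @convex_open_closure _ _ _ (1 - t / s) cO oO Od cp.
  rewrite subr_ge0 ltrBlDr ltrDl ler_pdivrMr// mul1r divr_gt0// ltW//.
  move=> /(_ isT); congr (Omega _).
  rewrite dE; apply/rowP => i; rewrite !mxE; field.
  by rewrite gt_eqF.
- have s1' := lt_trans st t1; have s0' : 0 < 1 - s by rewrite subr_gt0.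
  have := @convex_open_closure _ _ _ (1 - (1 - t) / (1 - s)) cO oO Od cq.
  rewrite subr_ge0 ltrBlDr ltrDl ler_pdivrMr// mul1r divr_gt0 ?subr_gt0//.
  rewrite lerD2l lerN2 ltW// => /(_ isT).
  congr (Omega _); rewrite dE; apply/rowP => i; rewrite !mxE; field.
  by rewrite gt_eqF.
Qed.

(** Uniqueness of geodesics: equality in F(x,y) + F(y,z) >= F(x,z) forces y to
    lie on the segment from x to z. *)
Lemma triangle_equality_collinear Omega x y z S T U :
  strictly_convex_domain Omega ->
  Omega x -> Omega y -> Omega z ->
  exit_time Omega x y S -> exit_time Omega y z T -> exit_time Omega x z U ->
  ln (S / (S - 1)) + ln (T / (T - 1)) = ln (U / (U - 1)) ->
  y = x + (U / S) *: (z - x).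
Proof.
move=> [] [] O0 bO oO cO sO Ox Oy Oz HS HT HU.
have S1 := exit_time_gt1 Oy HS; have T1 := exit_time_gt1 Oz HT.
have U1 := exit_time_gt1 Oz HU.
have S0 := lt_trans ltr01 S1; have T0 := lt_trans ltr01 T1.
have U0 := lt_trans ltr01 U1.
rewrite -lnM ?posrE ?ratio_gt0// => /ln_inj.
rewrite !posrE (mulr_gt0 (ratio_gt0 S1) (ratio_gt0 T1)) (ratio_gt0 U1).
move=> /(_ isT isT) eqSTU.
(* Equality of distances, in the form 1 - 1/U = (1 - 1/S) (1 - 1/T). *)
have UE : U * (S + T - 1) = S * T.
  have : (S - 1) * (T - 1) * (U - 1) * (S / (S - 1) * (T / (T - 1))) =
         (S - 1) * (T - 1) * (U - 1) * (U / (U - 1)) by rewrite eqSTU.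
  rewrite (_ : _ * (S / _ * _) = (U - 1) * (S * T)); last first.
    by field; rewrite !gt_eqF ?subr_gt0.
  rewrite (_ : _ * (U / _) = (S - 1) * (T - 1) * U); first by lra.
  by field; rewrite gt_eqF ?subr_gt0.
have ST0 : 0 < S + T - 1 by lra.
have {}UE : U = S * T / (S + T - 1) by rewrite -UE mulfK ?gt_eqF.
pose a := x + S *: (y - x); pose b := y + T *: (z - y).
pose c := x + U *: (z - x).
have [ca _] := exit_time_boundary oO Ox HS.
have [cb _] := exit_time_boundary oO Oy HT.
have [_ nc] := exit_time_boundary oO Ox HU.
(* The exit point c lies in the open segment between a and b; being on the
   boundary, it forces a = b. *)
have cE : c = a + (S / (S + T - 1)) *: (b - a).
  by rewrite /a /b /c UE; apply/rowP => i; rewrite !mxE; field; rewrite gt_eqF.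
have [ab|ab] := eqVneq a b.
  have : c = a by rewrite cE ab subrr scaler0 addr0.
  rewrite /c /a => /addrI H.
  by rewrite mulrC -scalerA H scalerA mulVf ?gt_eqF// scale1r addrC subrK.
exfalso; apply: nc; rewrite ((interior_id _).1 oO) -/c cE.
apply: (open_segment_interior cO oO sO O0 ca cb ab).
by rewrite divr_gt0//= ltr_pdivrMr//; lra.
Qed.

End ConvexSets.

(** * Maps that are affine on chords *)

Section AffineExtension.
Context (R : realType) (n : nat) (Omega : set 'rV[R]_n)
  (h : 'rV[R]_n -> 'rV[R]_n) (x0 : 'rV[R]_n)
  (oO : open Omega) (Ox0 : Omega x0).
Context (h_chord : forall (x y : 'rV[R]_n) (t : R),
  Omega x -> Omega y -> 0 <= t <= 1 ->
  Omega (x + t *: (y - x)) -> h (x + t *: (y - x)) = h x + t *: (h y - h x)).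

(** The directional derivative of h at x0, as a slope on the chord of Omega
    through x0 with direction v. *)
Let direction_exists (v : 'rV[R]_n) : exists w : 'rV[R]_n,
  forall s : R, 0 < s -> Omega (x0 + s *: v) -> h (x0 + s *: v) = h x0 + s *: w.
Proof.
have [e e0 He] := open_line v oO Ox0.
pose r := e / 2; have r0 : 0 < r by rewrite divr_gt0.
have Or : Omega (x0 + r *: v).
  by apply: He; rewrite gtr0_norm// /r ltr_pdivrMr// ltr_pMr// ltr1n.
exists (r^-1 *: (h (x0 + r *: v) - h x0)) => s s0 Os.
have line_scale (a b : R) : b != 0 ->
    x0 + a *: v = x0 + (a / b) *: (x0 + b *: v - x0).
  by move=> b0; apply/rowP => i; rewrite !mxE; field.
have [sr|/ltW rs] := leP s r.
- have E := line_scale s r (lt0r_neq0 r0).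
  rewrite E h_chord -?E//; first by rewrite scalerA.
  by rewrite divr_ge0 ?(ltW s0) ?(ltW r0)//= ler_pdivrMr// mul1r.
- have E := line_scale r s (lt0r_neq0 s0).
  rewrite E h_chord -?E//; last first.
    by rewrite divr_ge0 ?(ltW s0) ?(ltW r0)//= ler_pdivrMr// mul1r.
  by apply/rowP => i; rewrite !mxE; field; rewrite !gt_eqF.
Qed.

(** The slope L v is additive in v because h preserves midpoints, and it is
    homogeneous because the chords along v and c v, for c > 0, lie on the same
    line, while additivity gives the negative c; hence h is
    x |-> h x0 + L (x - x0) on Omega. *)
Lemma chord_affine_extension : exists (A : 'M[R]_n) (b : 'rV[R]_n),
  forall x, Omega x -> h x = x *m A + b.
Proof.
have [L LP] := choice direction_exists.
(* A single s > 0 determines the slope. *)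
have Luniq v w s : 0 < s -> Omega (x0 + s *: v) ->
    h (x0 + s *: v) = h x0 + s *: w -> L v = w.
  move=> s0 Os; rewrite LP// => /addrI/(congr1 ( *:%R s^-1)).
  by rewrite !scalerA mulVf ?gt_eqF// !scale1r.
have LD u v : L (u + v) = L u + L v.
  have [d d0 Hd] := open_line u oO Ox0.
  have [e e0 He] := open_line v oO Ox0.
  have [c c0 Hc] := open_line (u + v) oO Ox0.
  pose s := Num.min d (Num.min e c) / 2.
  have m0 : 0 < Num.min d (Num.min e c) by rewrite !lt_min d0 e0 c0.
  have s0 : 0 < s by rewrite divr_gt0.
  have : s < Num.min d (Num.min e c) by rewrite ltr_pdivrMr// ltr_pMr// ltr1n.
  rewrite !lt_min => /and3P[sd se sc].
  have Ou : Omega (x0 + s *: u) by apply: Hd; rewrite gtr0_norm.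
  have Ov : Omega (x0 + s *: v) by apply: He; rewrite gtr0_norm.
  have s20 : 0 < s / 2 by rewrite divr_gt0.
  have Ouv : Omega (x0 + (s / 2) *: (u + v)).
    by apply: Hc; rewrite gtr0_norm//; lra.
  have E : x0 + (s / 2) *: (u + v) =
      (x0 + s *: u) + 2^-1 *: ((x0 + s *: v) - (x0 + s *: u)).
    by apply/rowP => i; rewrite !mxE; field.
  apply: (Luniq _ _ (s / 2)) => //.
  rewrite E h_chord -?E//; last by lra.
  by rewrite !LP//; apply/rowP => i; rewrite !mxE; field.
have L0 : L 0 = 0 by apply: (addrI (L 0)); rewrite -LD !addr0.
have LN v : L (- v) = - L v by apply/eqP; rewrite -addr_eq0 -LD addNr L0.
have LZp c v : 0 < c -> L (c *: v) = c *: L v.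
  move=> c0; have [e e0 He] := open_line (c *: v) oO Ox0.
  have e20 : 0 < e / 2 by rewrite divr_gt0.
  have Oc : Omega (x0 + (e / 2) *: (c *: v)).
    by apply: He; rewrite gtr0_norm//; lra.
  apply: (Luniq _ _ (e / 2)) => //.
  have E : x0 + (e / 2) *: (c *: v) = x0 + (e / 2 * c) *: v by rewrite scalerA.
  by rewrite E LP -?E ?mulr_gt0// scalerA.
have LZ c v : L (c *: v) = c *: L v.
  case: (ltgtP 0 c) => [|c0|<-]; [exact: LZp| |by rewrite !scale0r].
  have -> : c *: v = - (- c *: v) by rewrite scaleNr opprK.
  by rewrite LN LZp ?oppr_gt0// scaleNr opprK.
have Llin : linear L by move=> c u v; rewrite LD LZ.
pose LL : {linear 'rV[R]_n -> 'rV[R]_n} :=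
  HB.pack L (GRing.isLinear.Build R _ _ _ L Llin).
exists (lin1_mx LL), (h x0 - L x0) => x Ox.
rewrite mul_rV_lin1 /=.
have := LP (x - x0) 1 ltr01; rewrite !scale1r [x0 + _]addrC subrK => -> //.
by rewrite LD LN addrCA addrA addrC addrA.
Qed.

End AffineExtension.

(** * Funk isometries *)

Section FunkIsometries.
Context {R : realType} {n : nat} (Omega : set 'rV[R]_n).
Implicit Types (f : Omega -> Omega) (x y z : Omega).

(** A Funk isometry is affine on every chord: it preserves exit times, hence the
    equality case of the triangle inequality and the place of the
    intermediate point. *)
Lemma funk_isometry_chord f x y z t : strictly_convex_domain Omega ->
  funk_isometry f -> 0 <= t <= 1 ->
  val z = val x + t *: (val y - val x) ->
  val (f z) = val (f x) + t *: (val (f y) - val (f x)).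
Proof.
move=> Osc [/bij_inj fI fF] /andP[t0 t1] zE.
have [[_ bO oO cO] _] := Osc.
have OP (u : Omega) : Omega (val u) by exact: set_valP.
have valN (u v : Omega) : u != v -> val u != val v by rewrite (inj_eq val_inj).
have fN (u v : Omega) : u != v -> val (f u) != val (f v).
  by move=> uv; apply: valN; rewrite (inj_eq fI).
have transfer (u v : Omega) T : u != v -> exit_time Omega (val u) (val v) T ->
    exit_time Omega (val (f u)) (val (f v)) T.
  move=> uv; exact: (exit_time_funk_metric cO oO bO (OP u) (OP v)
    (OP (f u)) (OP (f v)) (valN _ _ uv) (fN _ _ uv) (fF u v)).
have [xy|xy] := eqVneq x y.
  have -> : z = x by apply: val_inj; rewrite zE xy subrr scaler0 addr0.
  by rewrite xy subrr scaler0 addr0.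
have vxy : val y - val x != 0 by rewrite subr_eq0 eq_sym valN.
have [zx|zx] := eqVneq x z.
  have /eqP : t *: (val y - val x) = 0.
    by apply: (addrI (val x)); rewrite -zE zx addr0.
  rewrite scaler_eq0 (negPf vxy) orbF => /eqP ->.
  by rewrite zx scale0r addr0.
have [zy|zy] := eqVneq z y.
  have /eqP : (1 - t) *: (val y - val x) = 0.
    apply: (addrI (val z)); rewrite addr0 [in RHS]zy zE.
    by apply/rowP => i; rewrite !mxE; ring.
  by rewrite scaler_eq0 (negPf vxy) orbF subr_eq0 => /eqP <-;
    rewrite zy scale1r addrC subrK.
have t00 : 0 < t.
  rewrite lt_neqAle t0 andbT; apply: contra zx => /eqP t00.
  by apply/eqP/val_inj; rewrite zE -t00 scale0r addr0.
have t11 : t < 1.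
  rewrite lt_neqAle t1 andbT; apply: contra zy => /eqP t11.
  by apply/eqP/val_inj; rewrite zE t11 scale1r addrC subrK.
have [U HU] := exit_time_exists cO oO bO (OP x) (valN _ _ xy).
have U1 := exit_time_gt1 (OP y) HU.
have Hxz := exit_time_prefix t00 HU; rewrite -zE in Hxz.
have t01 : 0 <= t < 1 by rewrite t0.
have Hzy := exit_time_suffix t01 HU; rewrite -zE in Hzy.
have := @triangle_equality_collinear _ _ _ _ _ _ _ _ _ Osc (OP _) (OP _) (OP _)
  (transfer _ _ _ zx Hxz) (transfer _ _ _ zy Hzy) (transfer _ _ _ xy HU).
have -> : U / (U / t) = t by field; rewrite !gt_eqF// (lt_trans ltr01).
apply.
have tU : t < U := lt_trans t11 U1.
rewrite -lnM ?posrE ?ratio_gt0 ?(exit_time_gt1 (OP _) Hxz)//;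
  last exact: exit_time_gt1 (OP _) Hzy.
congr ln; field.
by rewrite mulN1r !subr_eq0 (gt_eqF U1) (gt_eqF t11) (gt_eqF t00) (gt_eqF tU).
Qed.

Lemma funk_isometry_affine f :
  strictly_convex_domain Omega -> funk_isometry f ->
  exists g : 'rV[R]_n -> 'rV[R]_n,
    [/\ affine_transformation g, g @` Omega = Omega & restricts_to g f].
Proof.
move=> Osc fF; have [[[x0 Ox0] bO oO cO] _] := Osc.
(* h extends f by the arbitrary value 0 outside Omega. *)
pose h (x : 'rV[R]_n) : 'rV[R]_n :=
  if (insub x : option Omega) is Some u then val (f u) else 0.
have hE (u : Omega) : h (val u) = val (f u) by rewrite /h valK.
have lift (x : 'rV[R]_n) : Omega x -> exists u : Omega, val u = x.
  by move=> Ox; exists (SigSub (mem_set Ox)).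
have [|A [b hA]] := @chord_affine_extension _ _ Omega h x0 oO Ox0.
  move=> x y t /lift[u <-] /lift[v <-] t01 /lift[w wE].
  by rewrite -wE !hE; exact: funk_isometry_chord t01 wE.
have gE (u : Omega) : val (f u) = val u *m A + b.
  by rewrite -hE hA//; exact: set_valP.
exists (fun x : 'rV[R]_n => x *m A + b); split => //.
- exists A; last by exists b.
  rewrite -row_free_unit; apply: inj_row_free => v vA.
  have [e e0 He] := open_line v oO Ox0.
  have e20 : 0 < e / 2 by rewrite divr_gt0.
  have [|u uE] := lift (x0 + (e / 2) *: v).
    by apply: He; rewrite gtr0_norm//; lra.
  have [w wE] := lift _ Ox0.
  have : u = w.
    apply: (bij_inj fF.1); apply: val_inj; rewrite !gE uE wE.
    by rewrite mulmxDl -scalemxAl vA scaler0 addr0.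
  move=> /(congr1 val); rewrite uE wE => /eqP; rewrite -subr_eq0 addrC addKr.
  by rewrite scaler_eq0 gt_eqF//= => /eqP.
- apply/seteqP; split => [_ [x /lift[u <-] <-]|y /lift[v <-]].
    by rewrite -gE; exact: set_valP.
  have [k _ fk] := fF.1.
  by exists (val (k v)); [exact: set_valP|rewrite -gE fk].
Qed.

Lemma affine_funk_isometry f (g : 'rV[R]_n -> 'rV[R]_n) :
  bounded_convex_domain Omega -> affine_transformation g ->
  g @` Omega = Omega -> restricts_to g f -> funk_isometry f.
Proof.
move=> [_ bO oO cO] [A Au [b gE]] gO fg.
have OP (u : Omega) : Omega (val u) by exact: set_valP.
have gI : injective g.
  by move=> x y;
    rewrite !gE => /addIr/(congr1 (mulmx^~ (invmx A))); rewrite !mulmxK.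
have fI : injective f by move=> x y /(congr1 val); rewrite !fg => /gI/val_inj.
split.
  have fS y : exists x, f x = y.
    have : (g @` Omega) (val y) by rewrite gO.
    move=> [x Ox gx]; exists (SigSub (mem_set Ox)).
    by apply: val_inj; rewrite fg.
  have [k fk] := choice fS.
  by exists k => // x; apply: fI; rewrite fk.
have gOP (z : 'rV[R]_n) : Omega (g z) <-> Omega z.
  split=> [|Oz]; last by rewrite -[in X in X _]gO; exists z.
  by rewrite -[in X in X _]gO => -[z' Oz' /gI <-].
move=> x y; have [->|xy] := eqVneq x y; first by rewrite /funk_metric !eqxx.
have vxy : val x != val y by rewrite (inj_eq val_inj).
have fxy : val (f x) != val (f y) by rewrite !(inj_eq val_inj) (inj_eq fI).
have [T HT] := exit_time_exists cO oO bO (OP x) vxy.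
have HT' : exit_time Omega (val (f x)) (val (f y)) T.
  rewrite !fg; apply: exit_time_affine HT => // t.
  rewrite !gE mulmxDl -scalemxAl mulmxBl.
  move: (val x *m A) (val y *m A) => p q.
  by apply/rowP => i; rewrite !mxE; ring.
by rewrite (funk_metric_exit_time _ _ _ _ _ HT)//
  (funk_metric_exit_time _ _ _ _ _ HT').
Qed.

End FunkIsometries.

Theorem corollary10p2 (R : realType) (n : nat) (Omega : set 'rV[R]_n)
    (Omega_sc : strictly_convex_domain Omega) :
  [set f : Omega -> Omega | funk_isometry f] =
  [set f : Omega -> Omega | exists g : 'rV[R]_n -> 'rV[R]_n,
     [/\ affine_transformation g, g @` Omega = Omega & restricts_to g f]].
Proof.
apply/seteqP; split => f /=; first exact: funk_isometry_affine.
move=> [g [gA gO fg]]; exact: affine_funk_isometry Omega_sc.1 gA gO fg.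
Qed.
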